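(* Let $(\mathcal{A},\partial)$ be a finitely generated semifree (fully noncommutative) DGA with action filtration over a field $\mathbf{k}$, and let $\mathcal{C}=\mathcal{A}/\mathcal{A}\partial(\mathcal{A})\mathcal{A}$ be its characteristic algebra. Then the natural unital algebra morphism $$H(\mathcal{A},\partial)\to \mathcal{C}$$ induced by the inclusion of the cycles $\ker\partial\subset\mathcal{A}$ (sending the class of a cycle $x$ to the class of $x$ in $\mathcal{C}$) is a monomorphism, i.e. injective.
   Context: Let $\mathbf{k}$ be an arbitrary field. $\langle a_1,\dots,a_m\rangle$ denotes the free, fully noncommutative, associative, unital $\mathbf{k}$-algebra on $a_1,\dots,a_m$. A DGA with action filtration is a pair $(\mathcal{A},\partial)$ where $\mathcal{A}=\langle a_1,\dots,a_m\rangle$ comes with a choice of free generators, each having a degree $|a_i|\in\mathbb{Z}/\mu\mathbb{Z}$ (for a fixed integer $\mu$) and an action $\ell(a_i)\in\mathbb{R}_{>0}$. These extend to monomials by $|r|=0$ for $r\in\mathbf{k}$, $|a_{i_1}\cdots a_{i_k}|=|a_{i_1}|+\dots+|a_{i_k}|$, and $\ell(0)=-\infty$, $\ell(r)=0$ for $r\in\mathbf{k}\setminus\{0\}$, $\ell(a_{i_1}\cdots a_{i_k})=\ell(a_{i_1})+\dots+\ell(a_{i_k})$. The map $\partial:\mathcal{A}\to\mathcal{A}$ is $\mathbf{k}$-linear of degree $-1$, satisfies $\partial^2=0$, $\partial|_{\mathbf{k}}=0$, and the graded Leibniz rule $\partial(\mathbf{a}\mathbf{b})=\partial(\mathbf{a})\mathbf{b}+(-1)^{|\mathbf{a}|}\mathbf{a}\,\partial(\mathbf{b})$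 for all monomials $\mathbf{a},\mathbf{b}$ (so $\mu$ is even unless $\operatorname{char}\mathbf{k}=2$, in order that the sign be meaningful). Finally, for every generator $a_i$, each monomial appearing in $\partial(a_i)$ with a non-zero coefficient has action strictly less than $\ell(a_i)$. $H(\mathcal{A},\partial)=\ker\partial/\operatorname{im}\partial$ is the homology algebra. $\mathcal{A}\partial(\mathcal{A})\mathcal{A}$ denotes the two-sided ideal of $\mathcal{A}$ generated by all boundaries $\partial(y)$, $y\in\mathcal{A}$. *)

(* Defs.v *)
From HB Require Import structures.
From mathcomp Require Import all_boot all_order all_algebra.
From mathcomp Require Import generic_quotient ring_quotient.
From mathcomp Require Import finmap.
From mathcomp Require Import boolp reals.
From mathcomp.multinomials Require Import monalg.

Set Implicit Arguments.
Unset Strict Implicit.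
Unset Printing Implicit Defensive.

Import Order.TTheory GRing.Theory Num.Theory.
Local Open Scope ring_scope.
Local Open Scope quotient_scope.

HB.mixin Record isTwoSidedMul (A : pzRingType) (S : A -> bool) := {
  ideal_mul_subproof : forall a b x : A, x \in S -> a * x * b \in S
}.

#[short(type="twoSidedIdeal")]
HB.structure Definition TwoSidedIdeal (A : pzRingType) :=
  {S of GRing.ZmodClosed A S & isTwoSidedMul A S}.

Section ImIdeal.
Variables (A : pzRingType) (d : A -> A).
Implicit Types a b x y : A.

(* The two-sided ideal A d(A) A, as the set of finite sums of a * d y * b *)
Definition im_ideal : {pred A} := fun x =>
  `[< exists s : seq (A * A * A), x = \sum_(t <- s) t.1.1 * d t.1.2 * t.2 >].

Fact im_ideal_zmod : zmod_closed im_ideal.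
Proof.
split=> [|x y]; rewrite !unfold_in.
  by apply/asboolP; exists [::]; rewrite big_nil.
move=> /asboolP[s ->] /asboolP[s' ->]; apply/asboolP.
exists (s ++ [seq (- t.1.1, t.1.2, t.2) | t <- s']).
rewrite big_cat big_map -sumrN /=; congr (_ + _); apply: eq_bigr => t _.
by rewrite !mulNr.
Qed.
HB.instance Definition _ := GRing.isZmodClosed.Build A im_ideal im_ideal_zmod.

Fact im_ideal_mul a b x : x \in im_ideal -> a * x * b \in im_ideal.
Proof.
rewrite !unfold_in => /asboolP[s ->]; apply/asboolP.
exists [seq (a * t.1.1, t.1.2, t.2 * b) | t <- s].
rewrite big_map mulr_sumr mulr_suml; apply: eq_bigr => t _ /=.
by rewrite !mulrA.
Qed.
HB.instance Definition _ := isTwoSidedMul.Build A im_ideal im_ideal_mul.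

End ImIdeal.

(* Quotient of a (noncommutative) left algebra by a two-sided ideal.  The     *)
(* ideal need not be proper, so the quotient may be the zero ring: it is a    *)
(* pzRingType and an lmodType, but cannot be an lalgType (which is nonzero).  *)
Section AlgQuotient.
Variables (k : pzRingType) (A : lalgType k) (I : twoSidedIdeal A).

Definition alg_quot : Type := Quotient.quot I.
HB.instance Definition _ := GRing.Zmodule.on alg_quot.
HB.instance Definition _ := EqQuotient.on alg_quot.

Local Notation Q := alg_quot.
Implicit Types (x y z : A) (u v w : Q) (c d : k).

Definition quot_proj (x : A) : Q := \pi_Q x.

Lemma quot_proj_eq x y : (quot_proj x = quot_proj y) <-> (x - y \in I).
Proof.
by split=> [/eqP|xy]; [|apply/eqP];
  rewrite -[_ == _]/(x == y %[mod Quotient.quot I]) -Quotient.idealrBE.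
Qed.

Lemma quot_projK u : quot_proj (repr u) = u. Proof. exact: reprK. Qed.

Lemma quot_proj_repr x : repr (quot_proj x) - x \in I.
Proof. by apply/quot_proj_eq; rewrite quot_projK. Qed.

Lemma quot_projP u : exists x, u = quot_proj x.
Proof. by exists (repr u); rewrite quot_projK. Qed.

Fact quot_proj_is_zmod_morphism : zmod_morphism quot_proj.
Proof.
by move=> x y; exact: (raddfB (\pi_(Quotient.quot I) : {additive _ -> _}) x y).
Qed.
HB.instance Definition _ :=
  GRing.isZmodMorphism.Build A Q quot_proj quot_proj_is_zmod_morphism.

Lemma ideal_mull a x : x \in I -> a * x \in I.
Proof. by move=> xI; rewrite -[_ * x]mulr1 ideal_mul_subproof. Qed.

Lemma ideal_mulr b x : x \in I -> x * b \in I.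
Proof. by move=> xI; rewrite -[x]mul1r ideal_mul_subproof. Qed.

Lemma ideal_scale c x : x \in I -> c *: x \in I.
Proof. by move=> xI; rewrite -[x]mul1r scalerAl ideal_mull. Qed.

Definition quot_one : Q := quot_proj 1.
Definition quot_mul u v : Q := quot_proj (repr u * repr v).
Definition quot_scale c u : Q := quot_proj (c *: repr u).

Lemma quot_mulE x y : quot_mul (quot_proj x) (quot_proj y) = quot_proj (x * y).
Proof.
apply/quot_proj_eq; set x' := repr _; set y' := repr _.
have -> : x' * y' - x * y = (x' - x) * y' + x * (y' - y).
  by rewrite mulrBl mulrBr addrA addrNK.
by apply: rpredD; [apply: ideal_mulr|apply: ideal_mull]; apply: quot_proj_repr.
Qed.

Lemma quot_scaleE c x : quot_scale c (quot_proj x) = quot_proj (c *: x).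
Proof. by apply/quot_proj_eq; rewrite -scalerBr; apply/ideal_scale/quot_proj_repr. Qed.

Fact quot_mulA : associative quot_mul.
Proof.
move=> u v w; have [[[x ->] [y ->]] [z ->]] := (quot_projP u, quot_projP v, quot_projP w).
by rewrite !quot_mulE mulrA.
Qed.
Fact quot_mul1 : left_id quot_one quot_mul.
Proof. by move=> u; have [x ->] := quot_projP u; rewrite quot_mulE mul1r. Qed.
Fact quot_mulq1 : right_id quot_one quot_mul.
Proof. by move=> u; have [x ->] := quot_projP u; rewrite quot_mulE mulr1. Qed.
Fact quot_mulDl : left_distributive quot_mul +%R.
Proof.
move=> u v w; have [[[x ->] [y ->]] [z ->]] := (quot_projP u, quot_projP v, quot_projP w).
by rewrite -raddfD !quot_mulE mulrDl raddfD.
Qed.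
Fact quot_mulDr : right_distributive quot_mul +%R.
Proof.
move=> u v w; have [[[x ->] [y ->]] [z ->]] := (quot_projP u, quot_projP v, quot_projP w).
by rewrite -raddfD !quot_mulE mulrDr raddfD.
Qed.
HB.instance Definition _ := GRing.Zmodule_isPzRing.Build Q
  quot_mulA quot_mul1 quot_mulq1 quot_mulDl quot_mulDr.

Fact quot_scaleA c d u : quot_scale c (quot_scale d u) = quot_scale (c * d) u.
Proof. by have [x ->] := quot_projP u; rewrite !quot_scaleE scalerA. Qed.
Fact quot_scale1 : left_id 1 quot_scale.
Proof. by move=> u; have [x ->] := quot_projP u; rewrite quot_scaleE scale1r. Qed.
Fact quot_scaleDr : right_distributive quot_scale +%R.
Proof.
move=> c u v; have [[x ->] [y ->]] := (quot_projP u, quot_projP v).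
by rewrite -raddfD !quot_scaleE scalerDr raddfD.
Qed.
Fact quot_scaleDl u : {morph quot_scale^~ u : c d / c + d}.
Proof.
by move=> c d; have [x ->] := quot_projP u; rewrite !quot_scaleE scalerDl raddfD.
Qed.
HB.instance Definition _ := GRing.Zmodule_isLmodule.Build k Q
  quot_scaleA quot_scale1 quot_scaleDr quot_scaleDl.

Fact quot_proj_is_monoid_morphism : monoid_morphism quot_proj.
Proof. by split=> // x y; rewrite -quot_mulE. Qed.
HB.instance Definition _ :=
  GRing.isMonoidMorphism.Build A Q quot_proj quot_proj_is_monoid_morphism.

Fact quot_proj_is_scalable : scalable quot_proj.
Proof. by move=> c x; rewrite -quot_scaleE. Qed.
HB.instance Definition _ :=
  GRing.isScalable.Build k A Q *:%R quot_proj quot_proj_is_scalable.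

Lemma quot_scalerAl c u v : c *: (u * v) = (c *: u) * v.
Proof.
have [[x ->] [y ->]] := (quot_projP u, quot_projP v).
by rewrite -rmorphM -!linearZ -rmorphM /= scalerAl.
Qed.

End AlgQuotient.

Lemma malg_scalerAr (K : monomType) (k : comNzRingType) (c : k) (x y : {malg k[K]}) :
  c *: (x * y) = x * (c *: y).
Proof.
apply/malgP=> w. rewrite mcoeffZ.
rewrite (mcoeffMlw w (fsubset_refl _) (msuppZ_le c y)).
rewrite (mcoeffMl x y w) mulr_sumr; apply: eq_bigr => v _; rewrite mulr_sumr.
by apply: eq_bigr => u _; rewrite mcoeffZ mulrnAr mulrCA.
Qed.

Lemma malg_sumE (K : choiceType) (k : nzRingType) (x : {malg k[K]}) :
  x = \sum_(w <- msupp x) x@_w *: << w >>.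
Proof.
rewrite {1}[x]monalgE; apply: eq_bigr => w _.
by apply/malgP=> v; rewrite mcoeffZ !mcoeffU mulrnAr mulr1.
Qed.

Lemma twisted_leibniz_ext (k : comNzRingType) (B : lalgType k) (d : {linear B -> B})
    (I J : Type) (r : seq I) (s : seq J) (a g : I -> k) (b : J -> k)
    (e : I -> B) (f : J -> B) :
  (forall c (x y : B), c *: (x * y) = x * (c *: y)) ->
  (forall i j, d (e i * f j) = d (e i) * f j + g i *: (e i * d (f j))) ->
  let x := \sum_(i <- r) a i *: e i in
  let y := \sum_(j <- s) b j *: f j in
  d (x * y) = d x * y + (\sum_(i <- r) (g i * a i) *: e i) * d y.
Proof.
move=> ZAr dM /=; rewrite !mulr_suml !raddf_sum !mulr_suml -big_split.
apply: eq_bigr => i _; rewrite /= !mulr_sumr raddf_sum -big_split.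
apply: eq_bigr => j _ /=; rewrite -!scalerAl -!ZAr scalerA !linearZ /= dM.
rewrite scalerDr -!scalerAl -!ZAr !scalerA; congr (_ + _ *: _).
  by rewrite mulrC.
by rewrite [LHS]mulrC mulrA.
Qed.

(* x |-> s x, for s a function on monomials; used with s w = (-1)^|w| *)
Definition mtwist (K : choiceType) (k : nzRingType) (s : K -> k) (x : {malg k[K]}) :
  {malg k[K]} := [malg w in msupp x => s w * x@_w].

Section MTwist.
Variables (K : choiceType) (k : comNzRingType) (s : K -> k).
Implicit Types x : {malg k[K]}.

Lemma mtwistE x w : (mtwist s x)@_w = s w * x@_w.
Proof. by rewrite mcoeffE; case: msuppP; rewrite ?mulr0. Qed.

Lemma mtwist0 : mtwist s 0 = 0.
Proof. by apply/malgP=> w; rewrite mtwistE mcoeff0 mulr0. Qed.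

Lemma mtwist_sumE x : mtwist s x = \sum_(v <- msupp x) (s v * x@_v) *: << v >>.
Proof.
apply/malgP=> w; rewrite mtwistE [x in LHS]malg_sumE !raddf_sum mulr_sumr /=.
apply: eq_bigr => v _; rewrite !mcoeffZ mcoeffU mulrA.
by case: eqP => [->|]; rewrite // !mulr0.
Qed.

Lemma mtwistK x : (forall w, s w * s w = 1) -> mtwist s (mtwist s x) = x.
Proof. by move=> ss; apply/malgP=> w; rewrite !mtwistE mulrA ss mul1r. Qed.

Lemma mtwist_anti (d : {linear {malg k[K]} -> {malg k[K]}}) :
  (forall v w, (d << v >>)@_w != 0 -> s w = - s v) ->
  forall x, d (mtwist s x) = - mtwist s (d x).
Proof.
move=> ds x; rewrite mtwist_sumE raddf_sum; apply/malgP=> w.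
rewrite mcoeffN mtwistE [x in RHS]malg_sumE !raddf_sum /= mulr_sumr -sumrN.
apply: eq_bigr => v _; rewrite !linearZ /= !mcoeffZ.
have [->|/ds ->] := eqVneq ((d << v >>)@_w) 0; first by rewrite !mulr0 oppr0.
by rewrite mulNr opprK mulrA.
Qed.

End MTwist.

Lemma mtwist_leibniz (K : monomType) (k : comNzRingType) (s : K -> k)
    (d : {linear {malg k[K]} -> {malg k[K]}}) :
  (forall v w, d (<< v >> * << w >>) =
     d << v >> * << w >> + s v *: (<< v >> * d << w >>)) ->
  forall x y, d (x * y) = d x * y + mtwist s x * d y.
Proof.
move=> dM x y; rewrite mtwist_sumE.
have := @twisted_leibniz_ext _ _ d _ _ (msupp x) (msupp y) (mcoeff^~ x) s
  (mcoeff^~ y) _ _ (@malg_scalerAr _ _) dM.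
by rewrite /= -!malg_sumE.
Qed.

Lemma twisted_diff_mul (B : pzRingType) (d tw : B -> B) :
  (forall x y, d (x * y) = d x * y + tw x * d y) ->
  (forall x, d (tw x) = - tw (d x)) -> tw 0 = 0 -> involutive tw ->
  forall a y b, d a = 0 -> d b = 0 -> d (tw a * y * b) = a * d y * b.
Proof.
move=> dM dtw tw0 twK a y b da db.
by rewrite !dM db mulr0 addr0 dtw da tw0 oppr0 mul0r add0r twK.
Qed.

(* Z / mu Z for an arbitrary integer mu (mu = 0 gives Z) *)
Definition Zmod (mu : int) : Type :=
  Quotient.quot (GRing.ZmodClosed.clone int (dvdz mu) _).
HB.instance Definition _ mu := GRing.Zmodule.on (Zmod mu).
HB.instance Definition _ mu := EqQuotient.on (Zmod mu).

Notation free_alg k m := {malg k[{fmonom 'I_m}]}.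

(* Additive extension to monomials of a degree or action of the generators *)
Definition mon_wt (G : nmodType) (m : nat) (f : 'I_m -> G) (w : {fmonom 'I_m}) : G :=
  \sum_(i <- w) f i.

(* (-1)^c for c in Z / mu Z.  It depends on the chosen representative of c    *)
(* unless mu is even or char k = 2, which [dga_even] requires below.          *)
Definition sgn_deg (k : fieldType) (mu : int) (c : Zmod mu) : k := (-1) ^ repr c.

Record dga (k : fieldType) (R : realType) (mu : int) (m : nat) := Dga {
  dga_deg : 'I_m -> Zmod mu;
  dga_act : 'I_m -> R;
  dga_diff : {linear free_alg k m -> free_alg k m};
  dga_even : (2 %| mu)%Z \/ 2%N \in [pchar k];
  dga_act_gt0 : forall i, 0 < dga_act i;
  dga_diff_deg : forall v w : {fmonom 'I_m},
    (dga_diff << v >>)@_w != 0 ->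
    mon_wt dga_deg w = mon_wt dga_deg v - \pi_(Zmod mu) 1;
  dga_diff2 : forall x, dga_diff (dga_diff x) = 0;
  dga_diffC : forall c : k, dga_diff c%:MP = 0;
  dga_leibniz : forall v w : {fmonom 'I_m},
    dga_diff (<< v >> * << w >>) =
      dga_diff << v >> * << w >>
      + sgn_deg k (mon_wt dga_deg v) *: (<< v >> * dga_diff << w >>);
  dga_diff_act : forall (i : 'I_m) (w : {fmonom 'I_m}),
    (dga_diff << fmu i >>)@_w != 0 -> mon_wt dga_act w < dga_act i
}.

Section Dga.
Variables (k : fieldType) (R : realType) (mu : int) (m : nat).
Variable D : dga k R mu m.
Local Notation A := (free_alg k m).
Local Notation d := (dga_diff D).
Implicit Types x y : A.
Local Notation sg w := (sgn_deg k (mon_wt (dga_deg D) w)).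

Lemma exprN1_even (e : int) :
  (2 %| mu)%Z \/ 2%N \in [pchar k] -> (mu %| e)%Z -> (-1 : k) ^ e = 1.
Proof.
case=> [mu2 mue|k2 _]; last by rewrite (oppr_pchar2 k2) exp1rz.
have /dvdzP [q ->] := dvdz_trans mu2 mue.
by rewrite mulrC -exprz_exp -exprnP sqrrN expr1n exp1rz.
Qed.

Lemma Zmod_eqP (e f : int) :
  (\pi_(Zmod mu) e = \pi_(Zmod mu) f) <-> (mu %| e - f)%Z.
Proof.
set I := GRing.ZmodClosed.clone int (dvdz mu) _.
have E : (e - f \in I) = (e == f %[mod Quotient.quot I]) by rewrite Quotient.idealrBE.
by split=> [/eqP|ef]; [|apply/eqP]; rewrite -[_ == _]E.
Qed.

Lemma Zmod_piB : zmod_morphism \pi_(Zmod mu).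
Proof.
exact: (raddfB (\pi_(Quotient.quot (GRing.ZmodClosed.clone int (dvdz mu) _))
                  : {additive _ -> _})).
Qed.

Lemma sgn_deg_pred (c : Zmod mu) :
  sgn_deg k (c - \pi_(Zmod mu) 1) = - sgn_deg k c.
Proof.
rewrite /sgn_deg; set c' := c - _.
have E : (mu %| repr c' - (repr c - 1))%Z.
  by apply/Zmod_eqP; rewrite Zmod_piB !reprK.
have N1 : (-1 : k) != 0 by rewrite oppr_eq0 oner_eq0.
rewrite -[repr c'](subrK (repr c - 1)) expfzDr // (exprN1_even (dga_even D) E).
by rewrite mul1r expfzDr // exprN1 invrN invr1 mulrN1.
Qed.

Lemma sgn_degK (c : Zmod mu) : sgn_deg k c * sgn_deg k c = 1.
Proof.
by rewrite /sgn_deg -exprMz_comm ?unitrN1 ?mulrNN ?mulr1 ?exp1rz //; apply: mulrC.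
Qed.

Definition twist : A -> A := mtwist (fun w => sg w).

Lemma twist0 : twist 0 = 0.
Proof. exact: mtwist0. Qed.

Lemma twistK x : twist (twist x) = x.
Proof. by apply: mtwistK => w; apply: sgn_degK. Qed.

Lemma diff_twist x : d (twist x) = - twist (d x).
Proof. by apply: mtwist_anti => v w /dga_diff_deg ->; apply: sgn_deg_pred. Qed.

Lemma diff_leibniz x y : d (x * y) = d x * y + twist x * d y.
Proof. by apply: mtwist_leibniz => v w; apply: dga_leibniz. Qed.

Lemma diff1 : d 1 = 0.
Proof. exact: (dga_diffC D 1). Qed.

Definition is_cycle : {pred A} := fun x => d x == 0.

Fact is_cycle_subalg : GRing.subsemialg_closed is_cycle.
Proof.
split; rewrite ?inE /is_cycle.
- by rewrite unfold_in diff1.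
- split=> [|x y]; rewrite !unfold_in ?linear0 // linearD => /eqP -> /eqP ->.
  by rewrite addr0.
- by move=> c x; rewrite !unfold_in linearZ /= => /eqP ->; rewrite scaler0.
- move=> x y; rewrite !unfold_in diff_leibniz => /eqP -> /eqP ->.
  by rewrite mul0r mulr0 addr0.
Qed.
HB.instance Definition _ := GRing.isSubalgClosed.Build k A is_cycle is_cycle_subalg.

Record cycle : predArgType := Cycle { cycle_val : A; _ : cycle_val \in is_cycle }.
HB.instance Definition _ := [isSub for cycle_val].
HB.instance Definition _ := [Choice of cycle by <:].
HB.instance Definition _ := [SubChoice_isSubLalgebra of cycle by <:].

Local Notation cval := (val : cycle -> A).

Lemma cycle_diff (z : cycle) : d (val z) = 0.
Proof. by case: z => z /= /eqP. Qed.

(* im d, as a two-sided ideal of the algebra of cycles *)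
Definition is_boundary : {pred cycle} := fun z => `[< exists y : A, val z = d y >].

Fact is_boundary_zmod : zmod_closed is_boundary.
Proof.
split=> [|z z']; rewrite !unfold_in.
  by apply/asboolP; exists 0; rewrite (raddf0 d) (rmorph0 cval).
move=> /asboolP[x' Ex] /asboolP[y' Ey]; apply/asboolP; exists (x' - y').
by rewrite (rmorphB cval) (raddfB d) /= Ex Ey.
Qed.
HB.instance Definition _ := GRing.isZmodClosed.Build cycle is_boundary is_boundary_zmod.

Fact is_boundary_mul (a b z : cycle) : z \in is_boundary -> a * z * b \in is_boundary.
Proof.
rewrite !unfold_in => /asboolP[y Ey]; apply/asboolP.
exists (twist (val a) * y * val b); rewrite !(rmorphM cval) /= Ey.
exact/esym/(twisted_diff_mul diff_leibniz diff_twist twist0 twistK)/cycle_diff/cycle_diff.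
Qed.
HB.instance Definition _ := isTwoSidedMul.Build cycle is_boundary is_boundary_mul.

Definition homology : Type := alg_quot (TwoSidedIdeal.clone cycle is_boundary _).
HB.instance Definition _ := GRing.PzRing.on homology.
HB.instance Definition _ := GRing.Lmodule.on homology.

Definition homology_class : cycle -> homology :=
  @quot_proj k cycle (TwoSidedIdeal.clone cycle is_boundary _).
HB.instance Definition _ := GRing.RMorphism.on homology_class.
HB.instance Definition _ := GRing.Linear.on homology_class.

Definition char_alg : Type := alg_quot (TwoSidedIdeal.clone A (im_ideal d) _).
HB.instance Definition _ := GRing.PzRing.on char_alg.
HB.instance Definition _ := GRing.Lmodule.on char_alg.

Definition char_class : A -> char_alg :=
  @quot_proj k A (TwoSidedIdeal.clone A (im_ideal d) _).
HB.instance Definition _ := GRing.RMorphism.on char_class.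
HB.instance Definition _ := GRing.Linear.on char_class.

Definition homology_to_char (h : homology) : char_alg := char_class (val (repr h : cycle)).

Lemma char_class_eq (x y : A) :
  char_class x = char_class y <->
  exists s : seq (A * A * A), x - y = \sum_(t <- s) t.1.1 * d t.1.2 * t.2.
Proof.
by rewrite quot_proj_eq unfold_in; split=> [/asboolP|?]; last apply/asboolP.
Qed.

Lemma homology_classP h : exists z, h = homology_class z.
Proof. exact: quot_projP. Qed.

Lemma homology_class_eq (z z' : cycle) :
  homology_class z = homology_class z' <-> exists y, val z - val z' = d y.
Proof.
rewrite quot_proj_eq unfold_in.
by split=> [/asboolP|zz']; [|apply/asboolP]; rewrite (rmorphB cval).
Qed.

Lemma homology_to_charE (z : cycle) :
  homology_to_char (homology_class z) = char_class (val z).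
Proof.
apply/quot_proj_eq; rewrite unfold_in; apply/asboolP.
have /homology_class_eq [y Ey] :
  homology_class (repr (homology_class z)) = homology_class z by exact: quot_projK.
by exists [:: (1, y, 1)]; rewrite big_seq1 mul1r mulr1 -Ey.
Qed.

Fact homology_to_char_is_zmod_morphism : zmod_morphism homology_to_char.
Proof.
move=> g h; have [[x ->] [y ->]] := (homology_classP g, homology_classP h).
by rewrite -raddfB !homology_to_charE !rmorphB.
Qed.
HB.instance Definition _ := GRing.isZmodMorphism.Build homology char_alg
  homology_to_char homology_to_char_is_zmod_morphism.

Fact homology_to_char_is_monoid_morphism : monoid_morphism homology_to_char.
Proof.
split=> [|g h]; first by rewrite -(rmorph1 homology_class) homology_to_charE !rmorph1.
have [[x ->] [y ->]] := (homology_classP g, homology_classP h).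
by rewrite -rmorphM !homology_to_charE !rmorphM.
Qed.
HB.instance Definition _ := GRing.isMonoidMorphism.Build homology char_alg
  homology_to_char homology_to_char_is_monoid_morphism.

Fact homology_to_char_is_scalable : scalable homology_to_char.
Proof.
move=> c h; have [x ->] := homology_classP h.
by rewrite -linearZ !homology_to_charE !linearZ.
Qed.
HB.instance Definition _ := GRing.isScalable.Build k homology char_alg *:%R
  homology_to_char homology_to_char_is_scalable.

End Dga.

Arguments homology_class {k R mu m} D _.
Arguments char_class {k R mu m} D _.
Arguments homology_to_char {k R mu m} D _.

(* Main.v *)
(* Since d(x b) = d(x) b + tw(x) d(b), the ideal A d(A) A is the left ideal     *)
(* A d(A).  If a cycle z is a sum of a_j x_j with boundaries x_j that are left   *)
(* independent, then 0 = d z = sum d(a_j) x_j makes every a_j a cycle, whence    *)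
(* a_j x_j, and so z, is a boundary.  Independent boundaries are found as        *)
(* follows.  The action filtration yields a total order on words, compatible     *)
(* with products, for which d strictly lowers leading words.  Let N be the least *)
(* number of boundaries whose left span contains z, and choose x_1, x_2, ...     *)
(* greedily, so that the least leading word, attained by q_i, of the elements of *)
(* x_i + L_(i-1), L_(i-1) = span(x_1, ..., x_(i-1)), is as small as possible     *)
(* among the sequences extending to one of length N with z in its span.  The     *)
(* leading words of the q_i increase: if q_i were below q_(i-1), then d q_i in   *)
(* L_(i-1) would be too low not to lie in L_(i-2), so that, writing q_i as       *)
(* x_i + a x_(i-1) modulo L_(i-2), d a = 0 and the boundary x_i + a x_(i-1)      *)
(* would have been a better choice than x_(i-1).  So no leading word of a q_i    *)
(* is a suffix of another one, and the leading words in a left combination of    *)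
(* the q_i cannot cancel.                                                        *)

Require Import Defs.
From mathcomp Require Import all_boot all_order all_algebra.
From mathcomp Require Import finmap boolp reals.
From mathcomp.multinomials Require Import monalg.
From mathcomp Require Import zify.

Set Implicit Arguments.
Unset Strict Implicit.
Unset Printing Implicit Defensive.

Import Order.TTheory GRing.Theory Num.Theory.
Local Open Scope ring_scope.

(** The claim reduces to [cycle_im_ideal]: a cycle in the ideal is a boundary. [cycle_lspan] is its
    abstract form, for an additive [d] that lowers levels and a class [B] of cycles closed under
    sums and under left multiplication by cycles. [adapted] records the greedy choice of boundaries;
    [adapted_extend] continues it up to the minimal length [N], and [adapted_coef] gives the left
    independence that [adapted_cycle] uses to see that all coefficients of a cycle are cycles. The
    order on words is that of [word_key], for integer weights supplied by [diff_weight_ex]. *)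

Local Notation "x * y" := (mmul x y) : monom_scope.

(** * Left linear combinations of a finite list *)

Section LeftSpan.
Variable A : pzRingType.
Implicit Types (a f g x y : A) (s t : seq A).

(** The coefficient of the head, the most recently added element, is exposed first: it is the one
    analysed below. *)
Fixpoint lspan s f : Prop :=
  if s is x :: s' then exists a, lspan s' (f - a * x) else f = 0.

Lemma lspan0 s : lspan s 0.
Proof. by elim: s => //= x s IHs; exists 0; rewrite mul0r subr0. Qed.

Lemma lspanD s f g : lspan s f -> lspan s g -> lspan s (f + g).
Proof.
elim: s f g => [|x s IHs] f g /=; first by move=> -> ->; rewrite addr0.
by move=> [a fs] [b gs]; exists (a + b); rewrite mulrDl opprD addrACA; exact: IHs.
Qed.

Lemma lspanM s a f : lspan s f -> lspan s (a * f).
Proof.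
elim: s f => [|x s IHs] f /=; first by move=> ->; rewrite mulr0.
by move=> [b fs]; exists (a * b); rewrite -mulrA -mulrBr; exact: IHs.
Qed.

Lemma lspanB s f g : lspan s f -> lspan s g -> lspan s (f - g).
Proof. by move=> fs gs; rewrite -mulN1r; apply/lspanD/lspanM. Qed.

Lemma lspan_cons x s f : lspan s f -> lspan (x :: s) f.
Proof. by move=> fs; exists 0; rewrite mul0r subr0. Qed.

Lemma lspan_mem s x : x \in s -> lspan s x.
Proof.
elim: s => // y s IHs; rewrite inE => /orP[/eqP ->|xs].
  by exists 1; rewrite mul1r subrr; exact: lspan0.
exact/lspan_cons/IHs.
Qed.

Lemma lspan_ind (P : A -> Prop) s : P 0 -> (forall f g, P f -> P g -> P (f + g)) ->
  (forall a x, x \in s -> P (a * x)) -> forall f, lspan s f -> P f.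
Proof.
move=> P0 PD; elim: s => [|x s IHs] PM f /=; first by move=> ->.
move=> [a fs]; rewrite -(subrK (a * x) f); apply: PD; last exact/PM/mem_head.
by apply: IHs fs => b y ys; apply: PM; rewrite inE ys orbT.
Qed.

Lemma lspan_sub s t : (forall x, x \in s -> lspan t x) ->
  forall f, lspan s f -> lspan t f.
Proof.
move=> st; apply: lspan_ind; first exact: lspan0.
  by move=> f g; apply: lspanD.
by move=> a x /st; apply: lspanM.
Qed.

End LeftSpan.

(** * Leading words for an order compatible with products *)

Section Level.
Variables (K : monomType) (k : fieldType) (key : K -> nat).
Hypothesis key_inj : injective key.
Hypothesis key_ltMl : forall u v v' : K, (key v < key v')%N -> (key (u * v)%M < key (u * v')%M)%N.
Hypothesis key_ltMr : forall u u' v : K, (key u < key u')%N -> (key (u * v)%M < key (u' * v)%M)%N.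
Local Notation A := {malg k[K]}.
Implicit Types (a b f g : A) (u v w : K).

(** The shift by one reserves level 0 for the zero element. *)
Definition level a : nat := \max_(v <- msupp a) (key v).+1.
Definition lead a w : bool := (a@_w != 0) && (level a == (key w).+1).

Lemma level_leP a n : reflect (forall v, a@_v != 0 -> (key v < n)%N) (level a <= n)%N.
Proof.
apply: (iffP (bigmax_leqP_seq _ _ _ _)) => [le_n v | lt_n v].
  by rewrite mcoeff_neq0 => av; exact: le_n.
by rewrite -mcoeff_neq0 => /lt_n.
Qed.

Lemma level0 : level 0 = 0%N.
Proof. by rewrite /level msupp0 big_nil. Qed.

Lemma lead_neq0 a w : lead a w -> a != 0.
Proof. by apply: contraL => /eqP ->; rewrite /lead mcoeff0 eqxx. Qed.

Lemma lead_level a w : lead a w -> level a = (key w).+1.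
Proof. by case/andP=> _ /eqP. Qed.

Lemma leadP a w : reflect (a@_w != 0 /\ forall v, a@_v != 0 -> v != w -> (key v < key w)%N) (lead a w).
Proof.
apply: (iffP andP) => [[aw /eqP Ea]|[aw lt_w]]; split=> //.
  move=> v av vw; rewrite ltn_neqAle (inj_eq key_inj) vw /=.
  by have := level_leP a _ (leqnn _) v av; rewrite Ea.
rewrite eqn_leq (level_leP a _ (leqnn _) w aw) andbT.
apply/level_leP => v av; rewrite ltnS.
by have [->//|vw] := eqVneq v w; rewrite ltnW ?lt_w.
Qed.

Lemma lead_ex a : a != 0 -> exists w, lead a w.
Proof.
move=> a0; have [/hasP[w aw w_top]|/hasPn no_top] :=
  boolP (has (fun w => level a == (key w).+1) (msupp a)).
  by exists w; rewrite /lead mcoeff_neq0 aw.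
have top_le: (level a <= (level a).-1)%N.
  apply/level_leP => v av; have /no_top : v \in msupp a by rewrite -mcoeff_neq0.
  by have := level_leP a _ (leqnn _) v av; case: (level a) => // n; rewrite ltnS eqSS leq_eqVlt eq_sym => /orP[->|].
case/eqP: a0; apply/malgP => v; rewrite mcoeff0; apply/eqP.
apply: contraT => /(level_leP a _ (leqnn _)) lt_v.
by move: top_le lt_v; case: (level a) => // n; rewrite ltnn.
Qed.

Lemma lead_uniq a v w : lead a v -> lead a w -> v = w.
Proof. by move=> /lead_level Ev /lead_level; rewrite Ev => -[/key_inj]. Qed.

Lemma lead_level_lt a b w : lead a w -> (level b < level a)%N -> lead (a + b) w.
Proof.
move=> /[dup] /lead_level -> /leadP[aw lt_w]; rewrite ltnS => /level_leP lt_b.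
apply/leadP; rewrite mcoeffD; split=> [|v].
  have [->|/lt_b] := eqVneq b@_w 0; first by rewrite addr0.
  by rewrite ltnn.
rewrite mcoeffD; have [->|/lt_b //] := eqVneq b@_v 0.
by rewrite addr0; apply: lt_w.
Qed.

Lemma lead_add a b w : lead a w -> ~~ lead b w ->
  lead (a + b) w \/ exists2 v, lead b v & lead (a + b) v /\ (key w < key v)%N.
Proof.
move=> aw bw; have [->|/lead_ex[v bv]] := eqVneq b 0; first by rewrite addr0; left.
have vw : v != w by apply: contraNneq bw => <-.
move: vw; rewrite -(inj_eq key_inj) neq_ltn => /orP[lt_vw|lt_wv].
  by left; apply: lead_level_lt; rewrite // (lead_level aw) (lead_level bv) ltnS.
right; exists v => //; split=> //; rewrite addrC; apply: lead_level_lt => //.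
by rewrite (lead_level aw) (lead_level bv) ltnS.
Qed.

Lemma lead_cancel a b w : lead a w -> lead b w ->
  exists c, (level (a - c * b) < level a)%N.
Proof.
move=> aw bw; exists (a@_w / b@_w)%:MP; rewrite (lead_level aw) ltnS.
move/leadP: aw => [_ lt_a]; move/leadP: bw => [bw lt_b].
apply/level_leP => v; rewrite mcoeffB mcoeffCM.
have [->|vw] := eqVneq v w; first by rewrite divfK // subrr eqxx.
have [->|av _] := eqVneq a@_v 0; last exact: lt_a.
have [->|bv _] := eqVneq b@_v 0; last exact: lt_b.
by rewrite mulr0 subrr eqxx.
Qed.

(** Any other pair of words has a product strictly below [u * v], so the top coefficient is a single
    product of nonzero scalars. *)
Lemma leadM a b u v : lead a u -> lead b v -> lead (a * b) (u * v)%M.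
Proof.
move=> /leadP[au lt_a] /leadP[bv lt_b].
have lt_uv u' v' : a@_u' != 0 -> b@_v' != 0 -> (u', v') != (u, v) ->
  (key (u' * v')%M < key (u * v)%M)%N.
  move=> /lt_a lt_u /lt_b lt_v; have [->|u'u] := eqVneq u' u.
    by have [->|/lt_v /key_ltMl-/(_ u)] := eqVneq v' v; rewrite ?eqxx.
  move=> _; apply: leq_trans (key_ltMr _ (lt_u u'u)) _.
  by have [->//|/lt_v /key_ltMl-/(_ u) /ltnW] := eqVneq v' v.
apply/leadP; split=> [|w].
  rewrite mcoeffMl (bigD1_seq u) ?fset_uniq -?mcoeff_neq0 //=.
  rewrite (bigD1_seq v) ?fset_uniq -?mcoeff_neq0 //= eqxx mulr1n.
  rewrite !big1_seq ?addr0 ?mulf_neq0 // => [u' /andP[u'u au']|v' /andP[v'v bv']].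
    rewrite big1_seq // => v' /andP[_ bv']; case: eqP => [E|]; last by rewrite mulr0n.
    have := lt_uv u' v'; rewrite E ltnn !mcoeff_neq0 au' bv' xpair_eqE (negPf u'u) /=.
    by move=> /(_ isT isT isT).
  case: eqP => [E|]; last by rewrite mulr0n.
  have := lt_uv u v'; rewrite E ltnn !mcoeff_neq0 bv' xpair_eqE (negPf v'v) andbF /=.
  by rewrite -mcoeff_neq0 au; move=> /(_ isT isT isT).
rewrite mcoeff_neq0 => /msuppM_le[u' [v' [au' bv' ->]]] ne.
apply: lt_uv; rewrite ?mcoeff_neq0 //.
by apply: contraNneq ne => -[-> ->].
Qed.

Hypothesis key_le_mull : forall u v : K, (key v <= key (u * v)%M)%N.
Hypothesis mul_suffix : forall u v u' v' : K, (u * v)%M = (u' * v')%M ->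
  (exists t, v = (t * v')%M) \/ (exists t, v' = (t * v)%M).

(** * Greedy sequences of boundaries *)

Section Adapted.
Variables (B : A -> Prop) (z : A) (N : nat).
Hypothesis N_min : forall s, (forall x, x \in s -> B x) -> lspan s z -> (N <= size s)%N.

(* Lists grow at the head: x :: s extends s by x, and t ++ s completes s.     *)
Definition completable (s : seq A) : Prop := exists t,
  [/\ forall x, x \in t -> B x, (size t + size s)%N = N & lspan (t ++ s) z].

(** The index is one more than the key of the latest leading word, so [n <= key m] makes these keys
    strictly increase. The last premise is the greedy choice. *)
Inductive adapted : seq A -> nat -> Prop :=
| AdaptedNil : adapted [::] 0
| AdaptedCons s n x q m of adapted s n & B x & lspan s (q - x) & lead q m
    & (n <= key m)%N & (forall f, lspan s f -> ~~ lead f m)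
    & (forall y p, B y -> lspan s (p - y) -> completable (y :: s) ->
         (level q <= level p)%N) :
  adapted (x :: s) (key m).+1.

Lemma adapted_sub s n : adapted s n -> forall x, x \in s -> B x.
Proof.
elim=> // {}s {}n x q m _ IHs Bx _ _ _ _ _ y.
by rewrite inE => /orP[/eqP ->|/IHs].
Qed.

Lemma lead_mull f w u : lead f w -> lead (<< u >> * f) (u * w)%M.
Proof.
apply: leadM; apply/leadP; rewrite mcoeffUU oner_eq0; split=> // v.
by rewrite mcoeffU1 [v == u]eq_sym => + /negPf uv; rewrite uv eqxx.
Qed.

(** Of [m] and an older leading word [v], one would be a suffix of the other: either [m] is then not
    new, or [key m <= key v] breaks the increase. *)
Lemma lead_not_multiple s n m :
  (forall f w, lspan s f -> lead f w ->
     exists u v f', [/\ w = (u * v)%M, (key v < n)%N, lspan s f' & lead f' v]) ->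
  (n <= key m)%N -> (forall f, lspan s f -> ~~ lead f m) ->
  forall u f, lspan s f -> ~~ lead f (u * m)%M.
Proof.
move=> gen le_nm m_new u f fs; apply/negP => fum.
have [u' [v [f' [E lt_vn f's f'v]]]] := gen _ _ fs fum.
have [[t Em]|[t Ev]] := mul_suffix E.
  have /negP[] := m_new (<< t >> * f') (lspanM _ f's).
  by rewrite Em; apply: lead_mull.
have := key_le_mull t m; rewrite -Ev => /(leq_trans le_nm).
by rewrite leqNgt lt_vn.
Qed.

(** In [f = a * q + g] with [g] in the span of [s], the leading words of the two terms differ and
    cannot cancel. *)
Lemma lead_split s x q m f a :
  lspan s (q - x) -> lead q m -> (forall u g, lspan s g -> ~~ lead g (u * m)%M) ->
  lspan s (f - a * x) -> a != 0 ->
  (level q <= level f)%N /\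
  forall w, lead f w -> (exists u, w = (u * m)%M) \/ exists2 g, lspan s g & lead g w.
Proof.
move=> sq qm new_m sf /lead_ex[u au].
pose g := f - a * q.
have gs : lspan s g.
  have -> : g = f - a * x - a * (q - x) by rewrite mulrBr opprB addrA subrK.
  exact/(lspanB sf)/lspanM.
have aqum := leadM au qm.
have le_q : (level q <= (key (u * m)%M).+1)%N by rewrite (lead_level qm) ltnS.
have -> : f = a * q + g by rewrite /g addrC subrK.
have [fum|[v gv [fv lt_v]]] := lead_add aqum (new_m u g gs).
  split=> [|w fw]; first by rewrite (lead_level fum).
  by left; exists u; apply: lead_uniq fw fum.
split=> [|w fw]; first by rewrite (lead_level fv) (leq_trans le_q) // ltnS ltnW.
by right; exists g => //; rewrite (lead_uniq fw fv).
Qed.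

Lemma adapted_gen s n : adapted s n -> forall f w, lspan s f -> lead f w ->
  exists u v f', [/\ w = (u * v)%M, (key v < n)%N, lspan s f' & lead f' v].
Proof.
elim=> [f w /= -> /lead_neq0|]; first by rewrite eqxx.
move=> {}s {}n x q m _ IHs _ sq qm le_nm new_m _ f w [a sf] fw.
have old g : lspan s g -> lead g w -> exists u v f',
    [/\ w = (u * v)%M, (key v < (key m).+1)%N, lspan (x :: s) f' & lead f' v].
  move=> gs /(IHs _ _ gs)[u [v [f' [-> lt_v f's f'v]]]].
  exists u, v, f'; split=> //; last exact: lspan_cons.
  by rewrite ltnS ltnW // (leq_trans lt_v).
have [a0|a0] := eqVneq a 0.
  by apply: old fw; rewrite a0 mul0r subr0 in sf.
have new_um := lead_not_multiple IHs le_nm new_m.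
have [_ /(_ w fw)[[u ->]|[g gs gw]]] := lead_split sq qm new_um sf a0; last exact: old gw.
exists u, m, q; split=> //; exists 1; by rewrite mul1r.
Qed.

(** Taking [f = 0] yields left independence; [adapted_extend] takes the differential of a later
    candidate. *)
Lemma adapted_coef s n x q m f a : adapted s n -> lspan s (q - x) -> lead q m ->
  (n <= key m)%N -> (forall g, lspan s g -> ~~ lead g m) ->
  lspan s (f - a * x) -> (level f < level q)%N -> a = 0.
Proof.
move=> /adapted_gen gen sq qm le_nm new_m sf; rewrite ltnNge; apply: contraNeq => a0.
by have [] := lead_split sq qm (lead_not_multiple gen le_nm new_m) sf a0.
Qed.

Variable d : {additive A -> A}.
Hypothesis B_cycle : forall x, B x -> d x = 0.
Hypothesis B_add : forall x y, B x -> B y -> B (x + y).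
Hypothesis B_mull : forall a x, d a = 0 -> B x -> B (a * x).
Hypothesis dMl : forall a x, d x = 0 -> d (a * x) = d a * x.
Hypothesis level_d : forall a, a != 0 -> (level (d a) < level a)%N.

Lemma lspan_d s f : (forall x, x \in s -> B x) -> lspan s f -> lspan s (d f).
Proof.
move=> Bs; elim/lspan_ind: f / => [|f g|a x xs]; first by rewrite raddf0; apply: lspan0.
  by rewrite raddfD; apply: lspanD.
by rewrite (dMl _ (B_cycle (Bs _ xs))); apply/lspanM/lspan_mem.
Qed.

Lemma adapted_extend s n : adapted s n -> completable s -> (size s < N)%N ->
  exists x n', adapted (x :: s) n' /\ completable (x :: s).
Proof.
move=> ad_s [t [Bt szN tsz]] lt_sN.
pose P l := `[< exists x q, [/\ B x, lspan s (q - x), completable (x :: s) & level q = l] >].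
have : exists l, P l.
  (* The last entry of a completion stands next to [s], hence is a candidate. *)
  case/lastP: t Bt szN tsz => [|t x] Bt; first by move=> E; rewrite -E ltnn in lt_sN.
  rewrite size_rcons cat_rcons => szN tsz; exists (level x); apply/asboolP; exists x, x.
  split=> //; [|by rewrite subrr; apply: lspan0|].
    by apply: Bt; rewrite mem_rcons mem_head.
  exists t; split=> //; last by rewrite -szN /= addnS.
  by move=> y yt; apply: Bt; rewrite mem_rcons inE yt orbT.
case/ex_minnP => _ /asboolP[x [q [Bx sq cx <-]]] q_min.
have {}q_min y p : B y -> lspan s (p - y) -> completable (y :: s) -> (level q <= level p)%N.
  by move=> By sp cy; apply: q_min; apply/asboolP; exists y, p.
have Bs := adapted_sub ad_s.
(* Otherwise [x] lies in the span of [s], and dropping it contradicts the minimality of [N]. *)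
have q0 : q != 0.
  apply: contraT => /negPn/eqP q0; case: cx => t' [Bt' szN' tsz'].
  suff /N_min : lspan (t' ++ s) z.
    rewrite size_cat -szN' /= addnS ltnn; apply=> y.
    by rewrite mem_cat => /orP[/Bt'|/Bs].
  apply: lspan_sub tsz' => y; rewrite mem_cat inE => /or3P[yt|/eqP ->|ys].
  - by apply: lspan_mem; rewrite mem_cat yt.
  - have := lspanM (-1) sq; rewrite q0 add0r mulrNN mul1r.
    by apply: lspan_sub => y' y's; apply: lspan_mem; rewrite mem_cat y's orbT.
  - by apply: lspan_mem; rewrite mem_cat ys orbT.
have [m qm] := lead_ex q0.
have new_m f : lspan s f -> ~~ lead f m.
  move=> fs; apply/negP => fm; have [c] := lead_cancel qm fm.
  rewrite ltnNge => /negP; apply; apply: q_min Bx _ cx.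
  by rewrite addrAC; apply: (lspanB sq); apply: lspanM.
exists x, (key m).+1; split=> //; apply: (AdaptedCons ad_s Bx sq qm) => //.
have Ex : x = - (q - x) + q by rewrite opprB subrK.
case: ad_s sq cx Bs new_m {q_min Ex szN tsz lt_sN} => // s' n' y p v ad_s' By sp pv le_v new_v p_min.
case=> a sq cx Bs new_m; rewrite ltn_neqAle; apply/andP; split.
  apply: contraTneq pv => /key_inj ->.
  by apply: new_m; exists 1; rewrite mul1r.
rewrite leqNgt; apply/negP => lt_mv.
have lt_qp : (level q < level p)%N by rewrite (lead_level qm) (lead_level pv) ltnS.
(* Modulo the span of [s'], [d q] is [d a * y], while its level is below that of [p]. *)
have da : d a = 0.
  apply: (adapted_coef ad_s' sp pv le_v new_v (f := d q)); last exact: ltn_trans (level_d q0) _.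
  have := lspan_d (adapted_sub ad_s') sq.
  by rewrite !raddfB /= (B_cycle Bx) subr0 (dMl _ (B_cycle By)).
have /negP[] : ~~ (level p <= level q)%N by rewrite -ltnNge.
apply: (p_min (x + a * y)); first exact/B_add/B_mull.
  by rewrite opprD addrA.
(* Adding [y] to the old completion recovers [x] as [(x + a * y) - a * y]. *)
case: cx => t' [Bt' szN' tsz']; exists (rcons t' y); split=> /=.
- by move=> w; rewrite mem_rcons inE => /orP[/eqP ->|/Bt'].
- by rewrite size_rcons -szN' /= addSnnS.
apply: lspan_sub tsz' => w; rewrite cat_rcons mem_cat !inE => /or4P[wt|/eqP ->|/eqP ->|ws].
- by apply: lspan_mem; rewrite mem_cat wt.
- suff: lspan (t' ++ [:: y, x + a * y & s']) (x + a * y - a * y) by rewrite addrK.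
  apply: lspanB; last apply: lspanM.
    by apply: lspan_mem; rewrite mem_cat !inE eqxx !orbT.
  by apply: lspan_mem; rewrite mem_cat !inE eqxx !orbT.
- by apply: lspan_mem; rewrite mem_cat !inE eqxx !orbT.
- by apply: lspan_mem; rewrite mem_cat !inE ws !orbT.
Qed.

Lemma adapted_cycle s n f : B 0 -> adapted s n -> lspan s f -> d f = 0 -> B f.
Proof.
move=> B0 ad_s; elim: ad_s f => {s n} [f /= -> //|s n x q m ad_s IHs Bx sq qm le_nm new_m _ f].
move=> [a sf] df.
have da : d a = 0.
  apply: (adapted_coef ad_s sq qm le_nm new_m (f := 0)); last by rewrite level0 (lead_level qm).
  have := lspan_d (adapted_sub ad_s) sf.
  by rewrite raddfB /= df (dMl _ (B_cycle Bx)).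
rewrite -(subrK (a * x) f); apply: B_add; last exact: B_mull.
by apply: IHs; rewrite // raddfB /= df (dMl _ (B_cycle Bx)) da mul0r subr0.
Qed.

End Adapted.

Lemma cycle_lspan (B : A -> Prop) (d : {additive A -> A}) :
  B 0 -> (forall x y, B x -> B y -> B (x + y)) ->
  (forall x, B x -> d x = 0) -> (forall a x, d a = 0 -> B x -> B (a * x)) ->
  (forall a x, d x = 0 -> d (a * x) = d a * x) ->
  (forall a, a != 0 -> (level (d a) < level a)%N) ->
  forall s z, (forall x, x \in s -> B x) -> lspan s z -> d z = 0 -> B z.
Proof.
move=> B0 B_add B_cycle B_mull dMl level_d s z Bs sz dz.
pose P n := `[< exists s, [/\ forall x, x \in s -> B x, lspan s z & size s = n] >].
have : exists n, P n by exists (size s); apply/asboolP; exists s.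
case/ex_minnP => N /asboolP[t [Bt tz szt]] N_min.
have {}N_min r : (forall x, x \in r -> B x) -> lspan r z -> (N <= size r)%N.
  by move=> Br rz; apply: N_min; apply/asboolP; exists r.
have ext i : (i <= N)%N -> exists r n,
    [/\ adapted B z N r n, completable B z N r & size r = i].
  elim: i => [_|i IHi lt_iN].
    exists [::], 0%N; split=> //; first exact: AdaptedNil.
    by exists t; rewrite cats0 addn0.
  have [r [n [ad_r cr Er]]] := IHi (ltnW lt_iN).
  have [|x [n' [ad_xr cxr]]] := adapted_extend N_min B_cycle B_add B_mull dMl level_d ad_r cr.
    by rewrite Er.
  by exists (x :: r), n'; rewrite /= Er.
have [r [n [ad_r [t' [_ szt' t'rz]] Er]]] := ext N (leqnn N).
have /size0nil E : size t' = 0%N by apply/eqP; rewrite -(eqn_add2r N) -{1}Er szt'.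
rewrite E in t'rz.
exact: (adapted_cycle B_cycle B_add B_mull dMl B0 ad_r t'rz dz).
Qed.

End Level.

(** * Integer weights and the order on words *)

Lemma weight_ex (I : finType) (r : I -> nat) (S : I -> seq (seq I)) :
  (forall i w j, w \in S i -> j \in w -> (r j < r i)%N) ->
  exists W : I -> nat, forall i, (0 < W i)%N /\
    forall w, w \in S i -> (\sum_(j <- w) W j < W i)%N.
Proof.
move=> rS; suff [W W_ok] : exists W : I -> nat, forall i, (0 < W i)%N /\
    ((r i < (\max_i r i).+1)%N -> forall w, w \in S i -> (\sum_(j <- w) W j < W i)%N).
  by exists W => i; have [W0 Wi] := W_ok i; split=> //; apply: Wi; rewrite ltnS leq_bigmax.
elim: (\max_i r i).+1 => [|n [W IHW]]; first by exists (fun=> 1%N).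
(* At rank [n] the words of [S i] only have letters of settled weight, so one more than the heaviest
   suffices. *)
pose W' i := if (r i < n)%N then W i else (\max_(w <- S i) \sum_(j <- w) W j).+1.
have W'E i w : w \in S i -> (r i < n.+1)%N -> (\sum_(j <- w) W' j = \sum_(j <- w) W j)%N.
  move=> wS; rewrite ltnS => le_rn; apply: eq_big_seq => j /(rS _ _ _ wS) lt_ji.
  by rewrite /W' (leq_trans lt_ji le_rn).
exists W' => i; split=> [|lt_in w wS].
  by rewrite /W'; case: ifP => // _; have [] := IHW i.
rewrite (W'E i) // /W'; case: ifP => [lt_rn|_]; first by have [_ ->] := IHW i.
by rewrite ltnS (leq_bigmax_seq _ wS).
Qed.

Section WordKey.
Variables (m : nat) (W : 'I_m -> nat).
Hypothesis W_gt0 : forall i, (0 < W i)%N.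
Implicit Types (i j : 'I_m) (u v w : seq 'I_m).
Local Open Scope nat_scope.

Definition word_wt w : nat := \sum_(i <- w) W i.

(* w as a numeral of length word_wt w in base m + 1: the letter i contributes *)
(* the digit i + 1 followed by W i - 1 zeros.                                 *)
Fixpoint word_key w : nat :=
  if w is i :: w' then i.+1 * m.+1 ^ ((W i).-1 + word_wt w') + word_key w' else 0.

Lemma word_wt_cons i w : word_wt (i :: w) = W i + word_wt w.
Proof. exact: big_cons. Qed.

Lemma word_wt_cat u v : word_wt (u ++ v) = word_wt u + word_wt v.
Proof. exact: big_cat. Qed.

Lemma word_key_cat u v : word_key (u ++ v) = word_key u * m.+1 ^ word_wt v + word_key v.
Proof.
elim: u => [|i u IHu] /=; first by rewrite mul0n.
by rewrite IHu word_wt_cat mulnDl -mulnA -expnD !addnA.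
Qed.

Lemma word_key_lt w : word_key w < m.+1 ^ word_wt w.
Proof.
elim: w => [|i w IHw]; first by rewrite expn_gt0.
rewrite word_wt_cons -(prednK (W_gt0 i)) addSn expnS /=.
have : m.+1 ^ word_wt w <= m.+1 ^ ((W i).-1 + word_wt w) by rewrite leq_pexp2l ?leq_addl.
have := ltn_ord i; nia.
Qed.

Lemma word_key_ge i w : m.+1 ^ (word_wt (i :: w)).-1 <= word_key (i :: w).
Proof. by rewrite word_wt_cons -(prednK (W_gt0 i)) addSn /= mulSn -addnA leq_addr. Qed.

(** A longer numeral with nonzero leading digit is larger. *)
Lemma word_key_lt_wt u v : word_wt u < word_wt v -> word_key u < word_key v.
Proof.
case: v => [|i v]; first by rewrite [X in _ < X]big_nil ltn0.
move=> lt_uv; apply: leq_trans (word_key_lt u) _; apply: leq_trans (word_key_ge i v).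
by rewrite leq_pexp2l // -ltnS prednK // (leq_ltn_trans _ lt_uv).
Qed.

Lemma word_wt_le u v : word_key u <= word_key v -> word_wt u <= word_wt v.
Proof. by apply: contraTT; rewrite -!ltnNge; apply: word_key_lt_wt. Qed.

Lemma word_key_inj : injective word_key.
Proof.
elim=> [|i u IHu] [|j v] //= E.
- by have := word_key_ge j v; rewrite /= -E leqn0 expn_eq0.
- by have := word_key_ge i u; rewrite /= E leqn0 expn_eq0.
have Ewt : word_wt (i :: u) = word_wt (j :: v).
  by apply/eqP; rewrite eqn_leq !word_wt_le //= E.
have Ee : (W j).-1 + word_wt v = (W i).-1 + word_wt u.
  by apply: succn_inj; rewrite -!addSn !prednK // -!word_wt_cons.
have lt_b i' w : word_key w < m.+1 ^ ((W i').-1 + word_wt w).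
  by apply: leq_trans (word_key_lt w) _; rewrite leq_pexp2l ?leq_addl.
(* Division by the common power of the base isolates the leading digits. *)
have ij : i = j.
  apply/val_inj/succn_inj; move: (congr1 (divn^~ (m.+1 ^ ((W i).-1 + word_wt u))) E).
  by rewrite Ee !divnMDl ?expn_gt0 // divn_small // divn_small ?addn0 // -Ee.
by move: E Ee; rewrite ij => E /addnI Ee; rewrite (IHu v) //; move: E; rewrite Ee => /addnI.
Qed.

Lemma word_key_ltMl u v v' : word_key v < word_key v' ->
  word_key (u ++ v) < word_key (u ++ v').
Proof.
move=> lt_v; rewrite !word_key_cat -addnS leq_add // leq_mul2l leq_pexp2l ?orbT //.
exact/word_wt_le/ltnW.
Qed.

Lemma word_key_ltMr u u' v : word_key u < word_key u' ->
  word_key (u ++ v) < word_key (u' ++ v).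
Proof. by move=> lt_u; rewrite !word_key_cat ltn_add2r ltn_pmul2r ?expn_gt0. Qed.

Lemma word_key_leMl u v : word_key v <= word_key (u ++ v).
Proof. by rewrite word_key_cat leq_addl. Qed.

End WordKey.

Lemma cat_suffix (T : Type) (u v u' v' : seq T) : u ++ v = u' ++ v' ->
  (exists t, v = t ++ v') \/ (exists t, v' = t ++ v).
Proof.
elim: u u' => [|x u IHu] [|y u'] /=; first by move=> ->; left; exists [::].
- by move=> ->; left; exists (y :: u').
- by move=> <-; right; exists (x :: u).
- by case=> _ /IHu.
Qed.

(** * Application to the differential *)

Section DgaBoundary.
Variables (k : fieldType) (R : realType) (mu : int) (m : nat) (D : dga k R mu m).
Local Notation A := (free_alg k m).
Local Notation d := (dga_diff D).

Lemma mon_wt_ge (f : 'I_m -> R) w j : (forall i, 0 < f i) -> j \in w -> f j <= \sum_(i <- w) f i.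
Proof.
move=> f_gt0; elim: w => //= i w IHw; rewrite inE big_cons => /orP[/eqP ->|/IHw le_j].
  by rewrite lerDl sumr_ge0 // => i' _; apply: ltW.
by rewrite (le_trans le_j) // lerDr ltW.
Qed.

Lemma fmonom_cons (i : 'I_m) w : FMonom (i :: w) = (fmu i * FMonom w)%M.
Proof. by apply: val_inj; rewrite /= fmM fmU. Qed.

Lemma malgUM (u v : {fmonom 'I_m}) : << u >> * << v >> = << (u * v)%M >> :> A.
Proof. by rewrite malgME !msuppU1 !big_seq_fset1 !mcoeffUU mulr1. Qed.

(** Generators are ranked by how many have smaller action. As actions are positive, every letter in
    the differential of a generator has lower rank; the Leibniz rule passes from generators to
    words. *)
Lemma diff_weight_ex : exists W : 'I_m -> nat, (forall i, (0 < W i)%N) /\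
  forall v w : {fmonom 'I_m}, (d << w >>)@_v != 0 -> (word_wt W v < word_wt W w)%N.
Proof.
pose r i := #|[set j | dga_act D j < dga_act D i]|.
have [|W W_ok] := @weight_ex _ r (fun i => [seq fmonom_val w | w <- msupp (d << fmu i >>)]).
  move=> i _ j /mapP[w wS ->] jw; apply: proper_card.
  have lt_ji : dga_act D j < dga_act D i.
    apply: le_lt_trans (dga_diff_act (w := w) _); last by rewrite mcoeff_neq0.
    by apply: mon_wt_ge => //; apply: dga_act_gt0.
  apply/properP; split; first by apply/subsetP => j'; rewrite !inE => /lt_trans; apply.
  by exists j; rewrite inE ?ltxx.
exists W; split=> [i|v [w]]; first by have [] := W_ok i.
elim: w v => [|i w IHw] v.
  have -> : FMonom [::] = mone :> {fmonom 'I_m} by apply: val_inj; rewrite /= fm1.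
  by rewrite [d _]diff1 mcoeff0 eqxx.
rewrite fmonom_cons -malgUM dga_leibniz mcoeffD mcoeffZ.
have wt_fmM (u1 u2 : {fmonom 'I_m}) : word_wt W (u1 * u2)%M = (word_wt W u1 + word_wt W u2)%N.
  by rewrite fmM word_wt_cat.
rewrite !wt_fmM fmU /= [word_wt W [:: i]]big_seq1.
have [->|+ _] := eqVneq ((d << fmu i >> * << FMonom w >>)@_v) 0.
  rewrite add0r => dv; have : (<< fmu i >> * d << FMonom w >>)@_v != 0.
    by apply: contraNneq dv => ->; rewrite mulr0.
  rewrite mcoeff_neq0 => /msuppM_le[v1 [v2 [+ + ->]]]; rewrite msuppU1 inE => /eqP ->.
  by rewrite -mcoeff_neq0 wt_fmM fmU [word_wt W [:: i]]big_seq1 ltn_add2l => /IHw.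
rewrite mcoeff_neq0 => /msuppM_le[v1 [v2 [v1i + ->]]]; rewrite msuppU1 inE => /eqP ->.
by rewrite wt_fmM ltn_add2r; have [_ ->] := W_ok i; rewrite ?map_f.
Qed.

Lemma im_ideal_lspan f : f \in im_ideal d ->
  exists s, (forall x, x \in s -> exists y, x = d y) /\ lspan s f.
Proof.
rewrite unfold_in => /asboolP[s ->].
exists (flatten [seq [:: d (t.1.2 * t.2); d t.2] | t <- s]); split.
  move=> x /flatten_mapP[t _]; rewrite !inE => /orP[/eqP ->|/eqP ->].
    by exists (t.1.2 * t.2).
  by exists t.2.
rewrite big_seq; elim/big_rec: _ => [|t g ts gs]; first exact: lspan0.
apply: lspanD gs.
have -> : t.1.1 * d t.1.2 * t.2 = t.1.1 * d (t.1.2 * t.2) - t.1.1 * twist D t.1.2 * d t.2.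
  by rewrite diff_leibniz mulrDr !mulrA addrK.
by apply: lspanB; apply/lspanM/lspan_mem/flatten_mapP; exists t; rewrite // !inE eqxx ?orbT.
Qed.

Lemma cycle_im_ideal f : f \in im_ideal d -> d f = 0 -> exists y, f = d y.
Proof.
have [W [W_gt0 W_d]] := diff_weight_ex.
pose key (w : {fmonom 'I_m}) := word_key W w.
have key_inj : injective key by move=> u v /(word_key_inj W_gt0)/val_inj.
move=> /im_ideal_lspan[s [ds sf]] df.
have key_ltMl u v v' : (key v < key v')%N -> (key (u * v)%M < key (u * v')%M)%N.
  by rewrite /key !fmM; apply: word_key_ltMl.
have key_ltMr u u' v : (key u < key u')%N -> (key (u * v)%M < key (u' * v)%M)%N.
  by rewrite /key !fmM; apply: word_key_ltMr.
have key_leMl u v : (key v <= key (u * v)%M)%N by rewrite /key fmM; apply: word_key_leMl.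
have suffix (u v u' v' : {fmonom 'I_m}) : (u * v)%M = (u' * v')%M ->
    (exists t, v = (t * v')%M) \/ (exists t, v' = (t * v)%M).
  move=> /(congr1 val); rewrite /= !fmM => /cat_suffix[[t E]|[t E]].
    by left; exists (FMonom t); apply: val_inj; rewrite /= fmM.
  by right; exists (FMonom t); apply: val_inj; rewrite /= fmM.
apply: (cycle_lspan key_inj key_ltMl key_ltMr key_leMl suffix _ _ _ _ _ _ ds sf df).
- by exists 0; rewrite raddf0.
- by move=> _ _ [x ->] [y ->]; exists (x + y); rewrite raddfD.
- by move=> _ [y ->]; apply: dga_diff2.
(* [twist] is an involution anticommuting with [d], so this witness has differential [a * d y]. *)
- move=> a _ da [y ->]; exists (twist D a * y).
  by rewrite diff_leibniz twistK diff_twist da [twist D 0]twist0 oppr0 mul0r add0r.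
- by move=> a x dx; apply: etrans (diff_leibniz D a x) _; rewrite [d x]dx mulr0 addr0.
move=> a /(lead_ex key)[w aw]; rewrite (lead_level aw) ltnS; apply/level_leP => v.
apply: contraNT => le_wv; rewrite [a]malg_sumE raddf_sum raddf_sum big_seq big1 // => u ua.
rewrite /= linearZ mcoeffZ; apply/eqP; rewrite mulf_eq0 orbC.
apply: contraNT le_wv => /norP[/W_d/(word_key_lt_wt W_gt0) lt_vu]; rewrite mcoeff_neq0 => _.
rewrite (leq_trans lt_vu) // -ltnS -(lead_level aw).
by apply: (level_leP key a _ (leqnn _)); rewrite mcoeff_neq0.
Qed.

End DgaBoundary.

Theorem theorem1p1 (k : fieldType) (R : realType) (mu : int) (m : nat)
    (D : dga k R mu m) :
  injective (homology_to_char D : {rmorphism homology D -> char_alg D}).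
Proof.
move=> g h; have [[x ->] [y ->]] := (homology_classP g, homology_classP h).
rewrite /= !homology_to_charE => /quot_proj_eq xy; apply/homology_class_eq.
by apply: cycle_im_ideal xy _; rewrite raddfB /= !cycle_diff subrr.
Qed.
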